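(* Let $T \ge 1$ and $N \ge T + \lfloor T^2/4 \rfloor + 2$ be integers, and let $F(T) = T + \lfloor T^2/4 \rfloor + 1$. Consider the variable packet-error coding problem with $N$ packets and at most $T$ adversarially altered packets, with erasure distortion. \begin{enumerate} \item If $0 \le R < \frac{1}{N-T}$, then there is no finite $D$ for which the rate-distortion pair $(R,D)$ is achievable. \item For every $R$ with $\frac{1}{N-T} \le R \le \frac{1}{N-2T}$, the rate-distortion pair $$\left(R,\ \frac{F(T)(N-T)\,(1-(N-2T)R)}{NT}\right)$$ is achievable. \end{enumerate}
   Context: Source alphabet $\mathcal{X} = [K] = \{1,\dots,K\}$ for an integer $K \ge 2$. A code of blocklength $n$ and rate $R$ consists of encoding functions $f_\ell : \mathcal{X}^n \to \mathcal{X}^{nR}$ for $\ell \in [N]$ (the packets $C_\ell = f_\ell(x^n)$) and a decoder $g : \prod_{\ell=1}^N \mathcal{X}^{nR} \to (\mathcal{X}\cup\{e\})^n$, where $e$ is a special erasure symbol. The erasure distortion is $d(x,\hat x)=0$ if $\hat x = x$, $1$ if $\hat x = e$, and $\infty$ otherwise, for $x\in\mathcal{X}$, $\hat x \in \mathcal{X}\cup\{e\}$; for strings, $d(x^n,\hat x^n) = \frac1n\sum_{i=1}^n d(x_i,\hat x_i)$. A code is feasible if $\max_{x^n} d(x^n, g(C_1,\dots,C_N)) = 0$ (exact recovery when no packet is altered). For a code define $$D_T = \max_{x^n \in \mathcal{X}^n}\ \max_{A \subseteq [N],\,|A|\le T}\ \max_{\tilde C_A} d\big(x^n, g(C_{A^c},\tilde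 C_A)\big),$$ where $g(C_{A^c},\tilde C_A)$ is the decoder output when packet $\ell$ equals $f_\ell(x^n)$ for $\ell \notin A$ and is an arbitrary $\tilde C_\ell \in \mathcal{X}^{nR}$ for $\ell \in A$. A pair $(R,D)$ is achievable if for every $\epsilon>0$ there exists a feasible code of some blocklength with rate at most $R+\epsilon$ and $D_T \le D+\epsilon$. *)

(* Defs.v *)
From Stdlib Require Import Reals.
From mathcomp Require Import all_boot.
Open Scope R_scope.

Set Implicit Arguments.
Unset Strict Implicit.
Unset Printing Implicit Defensive.

(* A code with N packets over the alphabet [K] = 'I_K:
   blocklength n > 0, packet length m (so the rate is m/n),
   encoders f_l : X^n -> X^m, decoder g : (X^m)^N -> (X u {e})^n,
   where the erasure symbol e is represented by None. *)
Record code (K N : nat) := Code {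
  blen : nat;
  plen : nat;
  blen_pos : (0 < blen)%N;
  enc : 'I_N -> blen.-tuple 'I_K -> plen.-tuple 'I_K;
  dec : {ffun 'I_N -> plen.-tuple 'I_K} -> blen.-tuple (option 'I_K)
}.

Definition rate K N (c : code K N) : R := (INR (plen c) / INR (blen c)).

(* Per-symbol erasure distortion with values in {0, 1, +oo};
   None stands for +oo. *)
Definition sym_dist K (x : 'I_K) (xh : option 'I_K) : option R :=
  match xh with
  | None => Some 1
  | Some y => if x == y then Some 0 else None
  end.

(* String distortion (1/n) sum_i d(x_i, xh_i), in [0,+oo] (None = +oo). *)
Definition str_dist K n (x : n.-tuple 'I_K) (xh : n.-tuple (option 'I_K))
  : option R :=
  let ds := [seq sym_dist p.1 p.2 | p <- zip x xh] in
  if has (fun o => if o is None then true else false) ds then None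
  else Some (INR (count (fun p => p.2 == None) (zip x xh)) / INR n).

Definition ele (d : option R) (b : R) : Prop :=
  match d with Some r => (r <= b) | None => False end.

Definition received K N (c : code K N) (x : (blen c).-tuple 'I_K)
  (A : {set 'I_N}) (Ct : {ffun 'I_N -> (plen c).-tuple 'I_K})
  : {ffun 'I_N -> (plen c).-tuple 'I_K} :=
  [ffun l => if l \in A then Ct l else @enc K N c l x].

Definition feasible K N (c : code K N) : Prop :=
  forall x : (blen c).-tuple 'I_K,
    str_dist x (@dec K N c [ffun l => @enc K N c l x]) = Some 0.

(* D_T(c) <= b, i.e. the max over x, |A| <= T, and Ct of the distortion
   is at most b (all maxima are over finite sets). *)
Definition DT_le K N (T : nat) (c : code K N) (b : R) : Prop :=
  forall (x : (blen c).-tuple 'I_K) (A : {set 'I_N})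
         (Ct : {ffun 'I_N -> (plen c).-tuple 'I_K}),
    (#|A| <= T)%N -> ele (str_dist x (@dec K N c (received x A Ct))) b.

Definition achievable (K N T : nat) (Rt D : R) : Prop :=
  forall eps : R, (0 < eps) ->
    exists c : code K N,
      feasible c /\ (rate c <= Rt + eps) /\ DT_le T c (D + eps).

Definition FT (T : nat) : nat := (T + (T * T) %/ 4 + 1)%N.

(* Main.v *)
(** Packets are the values at [0, ..., N-1] of integer polynomials of degree less
    than [N-T] that carry source symbols at [N-T] of these points, the set of
    systematic points being rotated so that all packets play the same role; each
    packet also contains the Gram matrix of all packets, whose cost is negligible.
    Positivity of the real norm shows that a packet having the right norm and the
    right inner products with [N-T] genuine packets is genuine. Hence each set of
    altered packets compatible with what is received is a vertex cover, of size at
    most [T], of the graph of inconsistent pairs, in which every vertex has a private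
    neighbour. The union of all such covers has at most
    [s * (T - s + 2) <= FT T] elements, [s] being the size of a minimum cover, and
    the symbols sent in clear outside of it are correctly decoded. Intermediate rates
    follow by time sharing with the analogous code of degree less than [N-2T], which
    corrects all errors. *)
Require Import Defs.
From Stdlib Require Import ZArith Reals Lra.
From mathcomp Require Import all_boot all_order all_algebra zify.
Set Implicit Arguments.
Unset Strict Implicit.
Unset Printing Implicit Defensive.
Import GRing.Theory Num.Theory.
Local Open Scope nat_scope.

(** * Union of the inclusion-minimal vertex covers of bounded size *)

Section TightCovers.

Variables (V : finType) (e : rel V).
Hypothesis e_sym : symmetric e.

Definition vcover (B : {set V}) :=
  [forall u, forall v, e u v ==> (u \in B) || (v \in B)].

Lemma vcoverP (B : {set V}) :
  reflect (forall u v, e u v -> (u \in B) || (v \in B)) (vcover B).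
Proof.
apply: (iffP forallP) => [cB u v euv | cB u].
  by have /forallP/(_ v)/implyP := cB u; apply.
by apply/forallP => v; apply/implyP; apply: cB.
Qed.

(** For a cover this is minimality under inclusion: only [a] covers the edge [e a h]; the case
    [h == a] is a loop. *)
Definition tight (B : {set V}) :=
  forall a, a \in B -> exists2 h, e a h & (h \notin B) || (h == a).

Definition outer_nbr (S X : {set V}) :=
  [set v | (v \notin S) && [exists u in X, e u v]].

Lemma outer_nbrU (S X Y : {set V}) :
  outer_nbr S (X :|: Y) = outer_nbr S X :|: outer_nbr S Y.
Proof.
apply/setP => v; rewrite !inE -andb_orr; congr (_ && _).
apply/existsP/orP => [[u /andP[]]|[] /existsP[u /andP[uX euv]]].
- by rewrite inE => /orP[] uX euv; [left|right]; apply/existsP; exists u; rewrite uX.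
- by exists u; rewrite inE uX.
- by exists u; rewrite inE uX orbT.
Qed.

Lemma outer_nbrS (S X Y : {set V}) : X \subset Y -> outer_nbr S X \subset outer_nbr S Y.
Proof. by move=> /setUidPr <-; rewrite outer_nbrU subsetUl. Qed.

Variable S : {set V}.
Hypothesis S_cover : vcover S.
Hypothesis S_min : forall B, vcover B -> #|S| <= #|B|.

(** Trading [X] for its neighbours outside [S] leaves a cover: [B] avoids [X], hence contains all
    neighbours of [X], so no edge lies inside [X]. Minimality of [S] forbids a gain. *)
Lemma outer_nbr_ge (B X : {set V}) :
  vcover B -> X \subset S :\: B -> #|X| <= #|outer_nbr S X|.
Proof.
move=> /vcoverP cB sX.
have XB u : u \in X -> (u \in S) && (u \notin B).
  by move=> /(subsetP sX); rewrite inE andbC.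
have cov : vcover ((S :\: X) :|: outer_nbr S X).
  have aux u v : e u v -> u \in X -> v \in (S :\: X) :|: outer_nbr S X.
    move=> euv uX; have /andP[uS uB] := XB u uX.
    have vB : v \in B by have := cB u v euv; rewrite (negPf uB).
    have vX : v \notin X by apply/negP => /XB; rewrite vB andbF.
    rewrite !inE vX /=; case: (v \in S) => //=.
    by apply/existsP; exists u; rewrite uX.
  apply/vcoverP => u v euv.
  have [uX|uX] := boolP (u \in X); first by rewrite (aux u v) ?orbT.
  have [vX|vX] := boolP (v \in X); first by rewrite (aux v u) // e_sym.
  have /vcoverP/(_ u v euv) := S_cover; rewrite !inE uX vX /=.
  by case/orP => ->; rewrite ?orbT.
have := S_min cov; rewrite cardsU cardsD.
have -> : #|S :&: X| = #|X|.
  by rewrite (setIidPr _) //; apply/subsetP => u /XB/andP[].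
have : #|X| <= #|S| by apply/subset_leq_card/subsetP => u /XB/andP[].
lia.
Qed.

(** The private neighbour of a point of [B] outside [S] is in [S], which covers their edge, and not
    in [B], since a loop would put the point itself in [S]. *)
Lemma tight_sub_outer_nbr (B : {set V}) :
  vcover B -> tight B -> B \subset S :|: outer_nbr S (S :\: B).
Proof.
move=> /vcoverP cB tB; apply/subsetP => a aB; rewrite !inE.
have [//|aS /=] := boolP (a \in S).
have [h eah hB] := tB a aB.
have /vcoverP/(_ a h eah) := S_cover; rewrite (negPf aS) /= => hS.
have hNB : h \notin B by case/orP: hB => // /eqP ha; rewrite -ha hS in aS.
by apply/existsP; exists h; rewrite inE hNB hS e_sym.
Qed.

Lemma outer_nbr_sub (B : {set V}) : vcover B -> outer_nbr S (S :\: B) \subset B :\: S.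
Proof.
move=> /vcoverP cB; apply/subsetP => v; rewrite !inE => /andP[-> /=].
case/existsP => u /andP[]; rewrite inE => /andP[uB _] /(cB u v).
by rewrite (negPf uB).
Qed.

(* [X |-> #|outer_nbr S X| - #|X|] is submodular and nonnegative on the subsets
   of each [S :\: B], so every [B] raises its value on the accumulated set by at
   most [T - #|S|]. *)
Lemma tight_covers_nbr T (l : seq {set V}) :
  {in l, forall B : {set V}, [/\ vcover B, tight B & #|B| <= T]} ->
  exists W : {set V}, [/\ W \subset S, #|outer_nbr S W| <= (T - #|S|).+1 * #|W| &
    {in l, forall B : {set V}, B \subset S :|: outer_nbr S W}].
Proof.
elim: l => [_|B l IHl lP].
  exists set0; split=> //; first exact: sub0set.
  rewrite cards0 muln0 leqn0 cards_eq0; apply/eqP/setP => v.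
  by rewrite !inE; apply/andP => -[_ /existsP[u]]; rewrite inE.
have [B' B'l|W [sWS cardW sl]] := IHl; first by apply: lP; rewrite inE B'l orbT.
have [cB tB leB] := lP B (mem_head _ _).
exists (W :|: (S :\: B)); split.
- by rewrite subUset sWS subsetDl.
- have [DW|DW] := boolP (S :\: B \subset W); first by rewrite (setUidPl DW).
  have D_gt0 : 0 < #|(S :\: B) :\: W| by rewrite card_gt0 setD_eq0.
  (* The increase is at most [#|B :\: S| - #|W :&: (S :\: B)|], hence at most
     [T - #|S| + #|(S :\: B) :\: W|]; as the last term is positive, [(T - #|S|).+1] times it
     suffices. *)
  rewrite outer_nbrU !cardsU.
  have := @outer_nbr_ge B (W :&: (S :\: B)) cB (subsetIr _ _).
  have: #|outer_nbr S (W :&: (S :\: B))| <=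
        #|outer_nbr S W :&: outer_nbr S (S :\: B)|.
    apply: subset_leq_card.
    by rewrite subsetI !outer_nbrS ?subsetIl ?subsetIr.
  have := subset_leq_card (outer_nbr_sub cB).
  have := cardsID S B; have := cardsID B S; rewrite (setIC S B).
  have := cardsID W (S :\: B); rewrite (setIC (S :\: B) W).
  have := S_min cB; move: cardW leB D_gt0.
  set o1 := #|outer_nbr S W|; set o2 := #|outer_nbr S (S :\: B)|.
  set o3 := #|_ :&: outer_nbr _ _|.
  nia.
- move=> B'; rewrite inE => /predU1P[->|B'l].
    apply: subset_trans (tight_sub_outer_nbr cB tB) _.
    by apply: setUS; rewrite outer_nbrU subsetUr.
  apply: subset_trans (sl B' B'l) _.
  by apply: setUS; rewrite outer_nbrU subsetUl.
Qed.

End TightCovers.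

Lemma card_bigcup_tight_covers (V : finType) (e : rel V) T (P : pred {set V}) :
  symmetric e ->
  {in P, forall B : {set V}, [/\ vcover e B, tight e B & #|B| <= T]} ->
  #|\bigcup_(B in P) B| <= FT T.
Proof.
move=> e_sym covP; have cT : vcover e setT by apply/vcoverP => u v; rewrite !inE.
case: (arg_minnP (fun B : {set V} => #|B|) cT) => S cS minS.
have [B0 PB0|P0] := pickP (mem P); last by rewrite big_pred0 // cards0.
have leS : #|S| <= T by have [cB _ leB] := covP B0 PB0; apply: leq_trans (minS _ cB) leB.
have [B|W [sWS cardW sl]] := @tight_covers_nbr V e e_sym S cS minS T (enum P).
  by rewrite mem_enum; apply: covP.
have: #|\bigcup_(B in P) B| <= #|S :|: outer_nbr e S W|.
  by apply/subset_leq_card/bigcupsP => B PB; apply: sl; rewrite mem_enum.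
move/leq_trans; apply; rewrite cardsU /FT.
have := subset_leq_card sWS; move: #|S| leS #|W| cardW => s leS w cardW lews.
have lews' : (T - s).+1 * w <= (T - s).+1 * s by rewrite leq_mul2l lews orbT.
have := leq_trans cardW lews'.
have [k ->] : exists k, T = s + k by exists (T - s); lia.
(* By AM-GM, [s * (T - s + 2)] is at most the integer part of [(T + 2) ^ 2 / 4], which is [FT T]. *)
have := (nat_AGM2 s k.+2).1.
have -> : (s + k.+2) ^ 2 = (s + k) * (s + k) + 4 * (s + k) + 4 by lia.
have -> : s * k.+2 = s + k.+1 * s by lia.
rewrite addKn; set p := (s + k) * (s + k).
have := divn_eq p 4; have := ltn_pmod p (isT : 0 < 4); lia.
Qed.

(** * Integer polynomials and Gram matrices of their values *)

Lemma leq_absz_sum (J : finType) (F : J -> int) :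
  absz (\sum_j F j)%R <= \sum_j absz (F j).
Proof.
elim/big_ind2: _ => // m a n b lema lenb.
by apply: leq_trans (leq_add lema lenb); lia.
Qed.

Section Polynomials.

Variable N : nat.
Implicit Types (H : {set 'I_N}) (p : {poly int}).
Local Open Scope ring_scope.

Lemma size_lincomb_leq (J : finType) k (a : J -> int) (q : J -> {poly int}) :
  (forall t, size (q t) <= k)%N -> (size (\sum_t a t *: q t)%R <= k)%N.
Proof.
move=> szq; apply: leq_trans (size_sum _ _ _) _; apply/bigmax_leqP => t _.
exact: leq_trans (size_scale_leq _ _) (szq t).
Qed.

Lemma poly_eq_on k p p' H :
  (size p <= k)%N -> (size p' <= k)%N -> (k <= #|H|)%N ->
  {in H, forall h : 'I_N, p.[h%:Z] = p'.[h%:Z]} -> p = p'.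
Proof.
move=> szp szp' leH eqH; apply/eqP; rewrite -subr_eq0; apply/eqP.
apply: (@roots_geq_poly_eq0 _ _ [seq (val h)%:Z | h <- enum H]).
- apply/allP => _ /mapP[h + ->]; rewrite mem_enum => /eqH eqh.
  by rewrite rootE hornerD hornerN eqh subrr.
- by rewrite map_inj_uniq ?enum_uniq // => a b [] /val_inj.
- rewrite size_map -cardE; apply: leq_trans leH.
  by apply: leq_trans (size_polyD _ _) _; rewrite size_polyN geq_max szp.
Qed.

(* The error [y - q(a)] is orthogonal to the values of [q] on [H], hence, its
   inner product with [q] being a polynomial of degree less than [k], also to
   [q(a)]; equality of the norms then forces it to vanish. *)
Lemma gram_rigidity (J : finType) k (q : J -> {poly int}) H (a : 'I_N)
    (y : J -> int) :
  (forall t, size (q t) <= k)%N -> (k <= #|H|)%N ->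
  {in H, forall h : 'I_N,
     \sum_t y t * (q t).[h%:Z] = \sum_t (q t).[a%:Z] * (q t).[h%:Z]} ->
  \sum_t y t * y t = \sum_t (q t).[a%:Z] * (q t).[a%:Z] ->
  forall t, y t = (q t).[a%:Z].
Proof.
move=> szq leH eqH eqn.
pose p := \sum_t (y t - (q t).[a%:Z]) *: q t.
have p0 : p = 0.
  apply: (@poly_eq_on k _ _ H); rewrite ?size_poly0 //.
    exact: size_lincomb_leq.
  move=> h hH; rewrite horner0 horner_sum.
  under eq_bigr do rewrite hornerZ mulrBl.
  by rewrite sumrB eqH // subrr.
have pa : \sum_t (y t - (q t).[a%:Z]) * (q t).[a%:Z] = 0.
  have: p.[(val a)%:Z] = 0 by rewrite p0 horner0.
  rewrite horner_sum; apply: etrans.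
  by apply: eq_bigr => t _; rewrite hornerZ.
have e0 : \sum_t (y t - (q t).[a%:Z]) ^+ 2 = 0.
  have -> : \sum_t (y t - (q t).[a%:Z]) ^+ 2 =
     \sum_t y t * y t - \sum_t (q t).[a%:Z] * (q t).[a%:Z]
     - 2 * \sum_t (y t - (q t).[a%:Z]) * (q t).[a%:Z].
    rewrite mulr_sumr -!sumrB; apply: eq_bigr => t _.
    by rewrite sqrrB -mulrnAr mulrBl; lia.
  by rewrite pa eqn subrr mulr0 subr0.
move=> t; apply/eqP; rewrite -subr_eq0 -sqrf_eq0; apply/eqP.
by apply: (psumr_eq0P _ e0) => // t' _; apply: sqr_ge0.
Qed.

Definition gram (J : finType) (q : J -> {poly int}) :
    {ffun 'I_N * 'I_N -> int} :=
  [ffun ab : 'I_N * 'I_N => \sum_t (q t).[(val ab.1)%:Z] * (q t).[(val ab.2)%:Z]].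

Definition packet (J : finType) (q : J -> {poly int}) (l : 'I_N) :
    {ffun J -> int} * {ffun 'I_N * 'I_N -> int} :=
  ([ffun t => (q t).[(val l)%:Z]], gram q).

End Polynomials.

(** * Packets trusted by every compatible message *)

Definition agreement N (P : eqType) (f g : 'I_N -> P) : {set 'I_N} :=
  [set l | f l == g l].

(** Two sets of [N - T] packets meet in at least [N - 2 * T], where [f] and [g] both equal [r]. *)
Lemma agreement_setI N T (P : eqType) (f g r : 'I_N -> P) :
  N - T <= #|agreement f r| -> N - T <= #|agreement g r| ->
  N - 2 * T <= #|agreement f g|.
Proof.
move=> fr gr.
have: #|agreement f r :&: agreement g r| <= #|agreement f g|.
  apply/subset_leq_card/subsetP => l; rewrite !inE.
  by move=> /andP[/eqP-> /eqP->].
have := cardsUI (agreement f r) (agreement g r).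
have : #|agreement f r :|: agreement g r| <= N by rewrite -[leqRHS]card_ord max_card.
lia.
Qed.

(* If packets [a] and [b] disagree with the transmitted inner product then one of
   them was altered; a loop marks a packet that is inconsistent by itself. *)
Lemma polytope_list N T (X J : finType) (q : X -> J -> {poly int})
    (r : 'I_N -> {ffun J -> int} * {ffun 'I_N * 'I_N -> int}) :
  2 * T < N -> (forall x t, size (q x t) <= N - T) ->
  exists2 U : {set 'I_N}, #|U| <= FT T &
    forall x, N - T <= #|agreement (packet (q x)) r| ->
    forall i, i \notin U -> packet (q x) i = r i.
Proof.
move=> ltTN szq; pose near x := N - T <= #|agreement (packet (q x)) r|.
have [x0 nx0|nox] := pickP near; last first.
  by exists set0; rewrite ?cards0 // => x; move: (nox x); rewrite /near => ->.
pose G := gram N (q x0).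
(* Two compatible messages share a packet, and each packet carries the whole Gram matrix. *)
have gramE x : near x -> gram N (q x) = G.
  move=> nx; have := agreement_setI nx nx0.
  move/(leq_trans (ltac:(lia) : 0 < N - 2 * T)).
  by rewrite card_gt0 => /set0Pn[l]; rewrite inE => /eqP[].
pose dot a b := (\sum_t (r a).1 t * (r b).1 t)%R.
pose e a b := ((a == b) && ((r a).2 != G)) || (dot a b != G (a, b)).
have e_sym : symmetric e.
  move=> a b; have dotC : dot a b = dot b a by apply: eq_bigr => t _; rewrite mulrC.
  have GC : G (a, b) = G (b, a) by rewrite !ffunE; apply: eq_bigr => t _; rewrite mulrC.
  by rewrite /e dotC GC eq_sym; case: (b =P a) => // ->.
pose Bx x := ~: agreement (packet (q x)) r.
have BxE x a : (a \notin Bx x) = (packet (q x) a == r a).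
  by rewrite inE negbK inE.
pose P := [pred B | [exists x, near x && (B == Bx x)]].
have covP : {in P, forall B : {set _}, [/\ vcover e B, tight e B & #|B| <= T]}.
  move=> _ /existsP[x /andP[nx /eqP->]]; split.
  - apply/vcoverP => u v; apply: contraTT; rewrite negb_or !BxE.
    case/andP => /eqP ru /eqP rv; rewrite /e /dot -ru -rv /= gramE //.
    rewrite eqxx andbF /= negbK -(gramE x nx) ffunE /=.
    by apply/eqP/eq_bigr => t _; rewrite !ffunE.
  - move=> a aB.
    have [/existsP[h /andP[eah hB]]|none] :=
      boolP [exists h, e a h && ((h \notin Bx x) || (h == a))]; first by exists h.
    (* With neither loop nor private neighbour, packet [a] has the right Gram matrix, norm and inner
       products with genuine packets, so rigidity makes it genuine. *)
    have noe h : (h \notin Bx x) || (h == a) -> ~~ e a h.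
      move=> hB; apply: contra none => eah; apply/existsP; exists h.
      by rewrite eah.
    have := noe a; rewrite eqxx orbT => /(_ isT); rewrite /e eqxx negb_or.
    rewrite !negbK => /andP[] /eqP ra2 /eqP raa.
    have ra1 t : (r a).1 t = (q x t).[(val a)%:Z]%R.
      apply: (@gram_rigidity _ _ (N - T) (q x) (agreement (packet (q x)) r)) => //.
      - move=> h; rewrite inE => /eqP rh.
        have := noe h; rewrite BxE rh eqxx => /(_ isT) /norP[_].
        rewrite negbK -(gramE x nx) ffunE /= => /eqP <-.
        by apply: eq_bigr => t' _; rewrite -rh ffunE.
      - by move: raa; rewrite /dot -(gramE x nx) ffunE.
    case/negP: aB; apply/negPn; rewrite BxE; apply/eqP.
    case: (r a) ra1 ra2 => r1 r2 /= ra1 ->; rewrite -(gramE x nx).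
    by congr (_, _); apply/ffunP => t; rewrite ffunE ra1.
  - by rewrite /Bx cardsCs setCK card_ord leq_subCl.
exists (\bigcup_(B in P) B); first exact: card_bigcup_tight_covers e_sym covP.
move=> x nx i iU; apply/eqP; rewrite -BxE; apply: contra iU => iB.
by apply/bigcupP; exists (Bx x) => //; apply/existsP; exists x; rewrite eqxx andbT.
Qed.

(** * Integral interpolation at cyclically shifted points *)

Section Interpolation.

Variables (N k : nat).
Hypothesis lekN : k <= N.

Lemma shift_subproof (c : 'I_N) j : (c + j) %% N < N.
Proof. by rewrite ltn_pmod // (leq_ltn_trans _ (ltn_ord c)). Qed.

Definition shift (c : 'I_N) (j : 'I_k) : 'I_N := Ordinal (shift_subproof c j).

Lemma shift_injl j : injective (shift^~ j).
Proof.
move=> c c' /(congr1 val)/= /eqP; rewrite eqn_modDr !modn_small //.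
by move/eqP/val_inj.
Qed.

Lemma shift_injr c : injective (shift c).
Proof.
move=> j j' /(congr1 val)/= /eqP; rewrite eqn_modDl.
rewrite !modn_small; [|exact: leq_trans (ltn_ord _) lekN..].
by move/eqP/val_inj.
Qed.

Local Open Scope ring_scope.

(** Lagrange basis without denominators, to stay over the integers; the data appear multiplied by
    nonzero constants, which still determine them. *)
Definition lagrange_num (c : 'I_N) (j : 'I_k) : {poly int} :=
  \prod_(i <- enum 'I_k | i != j) ('X - ((shift c i : nat)%:Z)%:P).

Lemma size_lagrange_num c j : size (lagrange_num c j) = k.
Proof.
rewrite /lagrange_num -big_filter size_prod_XsubC size_filter.
have := count_predC (pred1 j) (enum 'I_k); rewrite -cardE card_ord.
by rewrite (count_uniq_mem _ (enum_uniq _)) mem_enum.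
Qed.

Lemma horner_lagrange_num c j j' :
  ((lagrange_num c j).[(shift c j' : nat)%:Z] == 0) = (j' != j).
Proof.
rewrite /lagrange_num horner_prod prodf_seq_eq0.
apply/hasP/idP => [[i _ /andP[ij]]|j'j].
  rewrite hornerXsubC subr_eq0 => /eqP; case.
  by move/(@val_inj _ _ _ (shift c j') (shift c i))/shift_injr ->.
exists j'; first by rewrite mem_enum.
by rewrite j'j hornerXsubC subrr eqxx.
Qed.

Definition interp (c : 'I_N) (v : 'I_k -> int) : {poly int} :=
  \sum_j v j *: lagrange_num c j.

Lemma size_interp c v : (size (interp c v) <= k)%N.
Proof.
by apply: size_lincomb_leq => j; rewrite size_lagrange_num.
Qed.

Lemma interp_inj c v v' j :
  (interp c v).[(shift c j : nat)%:Z] = (interp c v').[(shift c j : nat)%:Z] ->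
  v j = v' j.
Proof.
have intE u : (interp c u).[(shift c j : nat)%:Z] =
              u j * (lagrange_num c j).[(shift c j : nat)%:Z].
  rewrite horner_sum (bigD1 j) //= hornerZ big1 ?addr0 // => i ij.
  apply/eqP; rewrite hornerZ mulf_eq0 horner_lagrange_num.
  by rewrite [j == i]eq_sym ij orbT.
rewrite !intE => /mulIf; apply; rewrite horner_lagrange_num.
by rewrite eqxx.
Qed.

Lemma horner_interp_bound :
  exists B : nat, forall (c l : 'I_N) (v : 'I_k -> int) (M : nat),
    (forall j, (absz (v j) <= M)%N) ->
    (absz (interp c v).[(val l)%:Z] <= B * M)%N.
Proof.
exists (\sum_(c < N) \sum_(l < N) \sum_(j < k)
          absz (lagrange_num c j).[(val l)%:Z])%N => c l v M vM.
rewrite horner_sum; apply: leq_trans (leq_absz_sum _) _.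
apply: (@leq_trans (\sum_(j < k) absz (lagrange_num c j).[(val l)%:Z] * M)%N).
  by apply: leq_sum => j _; rewrite hornerZ abszM mulnC leq_mul2l vM orbT.
rewrite -big_distrl leq_mul2r; apply/orP; right.
by rewrite (bigD1 c) //= (bigD1 l) //= -!addnA leq_addr.
Qed.

End Interpolation.

(** * Messages as families of polynomials *)

Section SourcePolynomials.

Variables (K N k w : nat).
Hypothesis lekN : k <= N.

(** A slot is a rotation and one of [w] copies; [w] is also the length of the words read as
    integers. A packet then holds [N * w] values of about [w] symbols, while the Gram matrix costs
    only a multiple of [w]. *)
Notation slots := ('I_N * 'I_w)%type.
Notation positions := (slots * 'I_k * 'I_w)%type.
Implicit Types x : {ffun positions -> 'I_K}.

Definition word x (t : slots) (j : 'I_k) : int :=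
  (enum_rank [ffun b : 'I_w => x (t, j, b)] : nat)%:Z%R.

Lemma word_bound x t j : absz (word x t j) <= K ^ w.
Proof.
rewrite /word absz_nat -[X in X ^ _]card_ord -[X in _ ^ X]card_ord -card_ffun.
exact: ltnW.
Qed.

Lemma word_inj x x' t j : word x t j = word x' t j ->
  forall b, x (t, j, b) = x' (t, j, b).
Proof.
by case=> /val_inj/enum_rank_inj/ffunP e b; have := e b; rewrite !ffunE.
Qed.

Definition source_poly x (t : slots) : {poly int} := interp t.1 (word x t).

Lemma size_source_poly x t : size (source_poly x t) <= k.
Proof. exact: size_interp. Qed.

Lemma packet_shift_inj x x' t j :
  packet (source_poly x) (shift t.1 j) = packet (source_poly x') (shift t.1 j) ->
  forall b, x (t, j, b) = x' (t, j, b).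
Proof.
case=> /ffunP/(_ t); rewrite !ffunE => e _; apply: word_inj.
exact: interp_inj e.
Qed.

Lemma packet_separating x x' :
  k <= #|agreement (N := N) (packet (source_poly x)) (packet (source_poly x'))| -> x = x'.
Proof.
move=> leka; apply/ffunP => -[[t j] b]; apply: word_inj.
apply: (interp_inj lekN (c := t.1)).
congr (_.[_]%R); apply: (poly_eq_on (k := k)) leka _; try exact: size_interp.
by move=> h; rewrite inE => /eqP[/ffunP/(_ t)]; rewrite !ffunE.
Qed.

(** A packet and an index [j] determine the rotation, so each packet is systematic for at most
    [w * k * w] positions. *)
Lemma card_shift_preim (U : {set 'I_N}) :
  #|[set i : positions | shift i.1.1.1 i.1.2 \in U]| <= #|U| * (w * k * w).
Proof.
pose phi (i : positions) := (shift i.1.1.1 i.1.2, (i.1.1.2, i.1.2, i.2)).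
have phi_inj : injective phi.
  move=> [[[c l] j] b] [[[c' l'] j'] b'] e.
  have /= e1 := congr1 fst e; have /= -> := congr1 (fun u => u.2.1.1) e.
  have /= ej := congr1 (fun u => u.2.1.2) e; have /= -> := congr1 (fun u => u.2.2) e.
  by move: e1; rewrite ej => /shift_injl ->.
rewrite -(card_imset _ phi_inj).
apply: leq_trans (_ : #|setX U [set: 'I_w * 'I_k * 'I_w]| <= _).
  apply/subset_leq_card/subsetP => _ /imsetP[i + ->].
  by rewrite !inE andbT.
by rewrite cardsX cardsT !card_prod !card_ord.
Qed.

Lemma packet_list_bounded T (r : 'I_N -> _) : k = N - T -> 2 * T < N ->
  exists2 E : {set positions}, #|E| <= FT T * (w * k * w) &
    forall x x', N - T <= #|agreement (packet (source_poly x)) r| ->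
      N - T <= #|agreement (packet (source_poly x')) r| ->
    forall i, i \notin E -> x i = x' i.
Proof.
move=> kE ltTN.
have [x t|U leU UP] := polytope_list (q := source_poly) r ltTN.
  by rewrite -kE size_source_poly.
exists [set i | shift i.1.1.1 i.1.2 \in U].
  by apply: leq_trans (card_shift_preim U) _; rewrite leq_mul2r leU orbT.
move=> x x' nx nx' [[t j] b]; rewrite inE => iU.
apply: packet_shift_inj; rewrite (UP x nx _ iU).
by rewrite -(UP x' nx' _ iU).
Qed.

End SourcePolynomials.

(** * Fitting packets into a finite alphabet *)

Section Quantization.

Definition int_of_ord C (o : 'I_(2 * C).+1) : int := ((o : nat)%:Z - C%:Z)%R.
Definition ord_of_int C (z : int) : 'I_(2 * C).+1 := inord (absz (z + C%:Z)%R).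

Lemma ord_of_intK C z : absz z <= C -> int_of_ord (ord_of_int C z) = z.
Proof. by move=> lez; rewrite /int_of_ord /ord_of_int inordK; lia. Qed.

Lemma quantized_packet K N k : 1 < K -> exists c, forall w, 0 < w ->
  exists (P : finType) (f : {ffun 'I_N * 'I_w * 'I_k * 'I_w -> 'I_K} -> 'I_N -> P)
         (h : P -> _),
    #|P| <= K ^ (N * w * w + c * w) /\
    forall x l, h (f x l) = packet (source_poly x) l.
Proof.
move=> K_gt1; have [B BP] := horner_interp_bound N k.
(* Overhead of [N * w] values with [(2 * B).+1] extra symbols each and of [N * N] Gram entries with
   [(2 * N * B * B).+1 + 3 * w] symbols each, constants being absorbed by [w >= 1]. *)
exists ((2 * B).+1 * N + 3 * N * N + (2 * N * B * B).+1 * N * N) => w w_gt0.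
pose C := B * K ^ w; pose C' := N * w * (C * C).
exists ({ffun 'I_N * 'I_w -> 'I_(2 * C).+1} * {ffun 'I_N * 'I_N -> 'I_(2 * C').+1})%type.
exists (fun x l => ([ffun t => ord_of_int C ((packet (source_poly x) l).1 t)],
                    [ffun t => ord_of_int C' ((packet (source_poly x) l).2 t)])).
exists (fun p : {ffun 'I_N * 'I_w -> 'I_(2 * C).+1} *
                 {ffun 'I_N * 'I_N -> 'I_(2 * C').+1} =>
  ([ffun t => int_of_ord (p.1 t)], [ffun t => int_of_ord (p.2 t)])).
have leC (x : {ffun 'I_N * 'I_w * 'I_k * 'I_w -> 'I_K}) t (l : 'I_N) :
  absz (source_poly x t).[(val l)%:Z]%R <= C.
  by apply: (BP t.1 l (word x t) (K ^ w)) => j; apply: word_bound.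
split=> [|x l]; last first.
  congr (_, _); apply/ffunP => t; rewrite !ffunE /= ?ffunE ord_of_intK ?leC //.
  apply: leq_trans (leq_absz_sum _) _.
  rewrite /C' -[N * w](_ : \sum_(t' : 'I_N * 'I_w) 1 = _); last first.
    by rewrite sum1_card card_prod !card_ord.
  rewrite big_distrl /=; apply: leq_sum => t' _.
  by rewrite abszM mul1n leq_mul ?leC.
rewrite card_prod !card_ffun !card_prod !card_ord.
have ltK n : n < K ^ n by apply: ltn_expl.
have K_gt0 n : 0 < K ^ n by rewrite expn_gt0 (ltnW K_gt1).
have leq_expr m n e : m <= n -> m ^ e <= n ^ e.
  by case: e => // e; rewrite leq_exp2r.
have le1 : (2 * C).+1 <= K ^ ((2 * B).+1 + w).
  rewrite expnD; apply: leq_trans (_ : (2 * B).+1 * K ^ w <= _).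
    by rewrite /C; have := K_gt0 w; nia.
  by rewrite leq_mul2r ltnW ?orbT.
have le2 : (2 * C').+1 <= K ^ ((2 * N * B * B).+1 + 3 * w).
  rewrite expnD; apply: leq_trans (_ : (2 * N * B * B).+1 * K ^ (3 * w) <= _); last first.
    by rewrite leq_mul2r ltnW ?orbT.
  rewrite [3 * w]mulnC expnM /C' /C.
  have lew : w <= K ^ w by apply: ltnW.
  have: w * (K ^ w * K ^ w) <= (K ^ w) ^ 3.
    by rewrite 3!expnS expn0 muln1 leq_mul2r lew orbT.
  have := K_gt0 w; nia.
apply: leq_trans (leq_mul (leq_expr _ _ _ le1) (leq_expr _ _ _ le2)) _.
rewrite -!expnM -expnD leq_exp2l //.
nia.
Qed.

End Quantization.

(** * Abstract encoders and their concatenation *)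

Section Encodable.

Variables K N T : nat.

(* The decoder lists all messages compatible with the received packets up to [T]
   alterations: correctness only concerns the encoders. *)
Definition separating (I : finType) (P : eqType)
    (f : {ffun I -> 'I_K} -> 'I_N -> P) :=
  forall x x', N - T <= #|agreement (f x) (f x')| -> x = x'.

(** [E] depends on [r] only, so a decoder can erase inside [E] and output the common symbol
    elsewhere. *)
Definition list_bounded (I : finType) (P : eqType)
    (f : {ffun I -> 'I_K} -> 'I_N -> P) d :=
  forall r, exists2 E : {set I}, #|E| <= d &
    forall x x', N - T <= #|agreement (f x) r| -> N - T <= #|agreement (f x') r| ->
    forall i, i \notin E -> x i = x' i.

Definition encodable (n m d : nat) :=
  exists (I P : finType) (f : {ffun I -> 'I_K} -> 'I_N -> P),
    [/\ #|I| = n, #|P| <= K ^ m, separating f & list_bounded f d].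

Lemma agreement_le (P Q : eqType) (f g : 'I_N -> P) (f' g' : 'I_N -> Q) :
  (forall l, f l = g l -> f' l = g' l) ->
  #|agreement f g| <= #|agreement f' g'|.
Proof.
move=> H; apply/subset_leq_card/subsetP => l; rewrite !inE.
by move=> /eqP/H->.
Qed.

(** Applying [h] preserves equality of packets, so agreements can only grow from [f] to [g]. *)
Lemma encodable_recode (I P : finType) (Q : eqType) m d
    (f : {ffun I -> 'I_K} -> 'I_N -> P) (g : {ffun I -> 'I_K} -> 'I_N -> Q)
    (h : P -> Q) :
  #|P| <= K ^ m -> (forall x l, h (f x l) = g x l) ->
  separating g -> list_bounded g d -> encodable #|I| m d.
Proof.
move=> leP hf sepg lbg; exists I, P, f; split=> // [x x' le|r].
  apply: sepg; apply: leq_trans le _; apply: agreement_le => l.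
  by rewrite -!hf => ->.
have [E leE EP] := lbg (h \o r); exists E => // x x' le le'.
by apply: EP; [apply: leq_trans le _|apply: leq_trans le' _];
  apply: agreement_le => l /= <-; rewrite hf.
Qed.

Lemma encodable0 : 0 < K -> encodable 0 0 0.
Proof.
move=> K_gt0; exists 'I_0, unit, (fun _ _ => tt).
rewrite card_ord card_unit expn0; split=> // [x x' _|r].
  by apply/ffunP => -[].
by exists set0; rewrite ?cards0 // => x x' _ _ [].
Qed.

(** Pairs of packets agree only where both components do, so one set of alterations serves both
    codes. *)
Lemma encodableD n m d n' m' d' :
  encodable n m d -> encodable n' m' d' -> encodable (n + n') (m + m') (d + d').
Proof.
move=> [I [P [f [cI cP sepf lbf]]]] [I' [P' [f' [cI' cP' sepf' lbf']]]].
pose lx (x : {ffun I + I' -> 'I_K}) := [ffun i => x (inl i)].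
pose rx (x : {ffun I + I' -> 'I_K}) := [ffun i => x (inr i)].
exists (I + I')%type, (P * P')%type, (fun x l => (f (lx x) l, f' (rx x) l)).
rewrite card_sum card_prod cI cI' expnD leq_mul //; split=> // [x x' le|r].
  have /ffunP el : lx x = lx x'.
    by apply: sepf; apply: leq_trans le _; apply: agreement_le => l [].
  have /ffunP er : rx x = rx x'.
    by apply: sepf'; apply: leq_trans le _; apply: agreement_le => l [].
  by apply/ffunP => -[] i; [have := el i|have := er i]; rewrite !ffunE.
have [E leE EP] := lbf (fun l => (r l).1).
have [E' leE' EP'] := lbf' (fun l => (r l).2).
exists ((inl @: E) :|: (inr @: E')).
  apply: leq_trans (leq_card_setU _ _).1 _.
  by apply: leq_add; apply: leq_trans (leq_imset_card _ _) _.
move=> x x' le le' [] i; rewrite inE negb_or => /andP[iE iE'].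
- have : lx x i = lx x' i.
    apply: EP; last by apply: contra iE => iE; apply/imsetP; exists i.
    + by apply: leq_trans le _; apply: agreement_le => l <-.
    + by apply: leq_trans le' _; apply: agreement_le => l <-.
  by rewrite !ffunE.
- have : rx x i = rx x' i.
    apply: EP'; last by apply: contra iE' => iE'; apply/imsetP; exists i.
    + by apply: leq_trans le _; apply: agreement_le => l <-.
    + by apply: leq_trans le' _; apply: agreement_le => l <-.
  by rewrite !ffunE.
Qed.

Lemma encodableM p n m d :
  0 < K -> encodable n m d -> encodable (p * n) (p * m) (p * d).
Proof.
move=> K_gt0 e; elim: p => [|p IHp]; first exact: encodable0.
by rewrite !mulSn; apply: encodableD.
Qed.

End Encodable.

(** * From encoders to codes *)

Lemma str_dist_bound K n d (x : n.-tuple 'I_K) (y : n.-tuple (option 'I_K))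
    (E : {set 'I_n}) :
  #|E| <= d ->
  (forall i, tnth y i = Some (tnth x i) \/ tnth y i = None /\ i \in E) ->
  exists2 c, c <= d & str_dist x y = Some (Rdiv (INR c) (INR n)).
Proof.
move=> leE H.
have zipE : zip x y = [seq (tnth x i, tnth y i) | i <- enum 'I_n].
  rewrite -{1}(map_tnth_enum x) -{1}(map_tnth_enum y).
  by elim: (enum 'I_n) => //= i s ->.
rewrite /str_dist zipE; case: ifP => [|_].
  rewrite !has_map => /hasP[i _ /=].
  by case: (H i) => [->|[-> _]] //=; rewrite eqxx.
eexists; last by reflexivity.
apply: leq_trans leE; rewrite count_map cardE -size_filter.
apply: uniq_leq_size; first by rewrite filter_uniq // enum_uniq.
move=> i; rewrite mem_filter mem_enum /= => /andP[/eqP yi _].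
by rewrite mem_enum; case: (H i) => [|[]//]; rewrite yi.
Qed.

Lemma encodable_code K N T n m d : 1 < K -> 0 < n -> encodable K N T n m d ->
  exists c : code K N,
    [/\ feasible c, rate c = (Rdiv (INR m) (INR n)) & DT_le T c (Rdiv (INR d) (INR n))].
Proof.
move=> K_gt1 n_gt0 [I [P [f [cI cP sepf lbf]]]].
have K_gt0 := ltnW K_gt1.
have leP : #|P| <= #|{:m.-tuple 'I_K}| by rewrite card_tuple card_ord.
pose e (p : P) : m.-tuple 'I_K := enum_val (widen_ord leP (enum_rank p)).
have e_inj : injective e.
  by move=> p p' /enum_val_inj/(congr1 val)/= /val_inj/enum_rank_inj.
pose src (x : n.-tuple 'I_K) : {ffun I -> 'I_K} :=
  [ffun i => tnth x (cast_ord cI (enum_rank i))].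
pose pos (j : 'I_n) : I := enum_val (cast_ord (esym cI) j).
have srcE x j : src x (pos j) = tnth x j.
  by rewrite ffunE enum_valK cast_ordKV.
have src_inj x x' : src x = src x' -> x = x'.
  by move=> exx; apply: eq_from_tnth => j; rewrite -!srcE exx.
have pos_inj : injective pos by move=> j j' /enum_val_inj/cast_ord_inj.
pose en (l : 'I_N) x := e (f (src x) l).
pose near x (r : {ffun 'I_N -> m.-tuple 'I_K}) :=
  N - T <= #|agreement (en^~ x) r|.
(* Output a symbol only if all compatible messages share it, and erase otherwise. *)
pose de r := [tuple [pick y | [forall x, near x r ==> (tnth x i == y)]] | i < n].
have deP r x i : near x r -> tnth (de r) i = Some (tnth x i) \/
    tnth (de r) i = None /\ exists2 x', near x' r & tnth x i != tnth x' i.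
  move=> nx; rewrite tnth_mktuple; case: pickP => [y /forallP/(_ x)|none].
    by rewrite nx => /eqP ->; left.
  right; split=> //; have /negbT := none (tnth x i).
  rewrite negb_forall => /existsP[x']; rewrite negb_imply eq_sym.
  by case/andP; exists x'.
exists (@Code K N n m n_gt0 en de); split=> //=.
- move=> x; have nx : near x [ffun l => en l x].
    rewrite /near (_ : agreement _ _ = setT) ?cardsT ?card_ord ?leq_subr //.
    by apply/setP => l; rewrite !inE ffunE eqxx.
  have [|i|c] := @str_dist_bound K n 0 x (de [ffun l => en l x]) set0.
  - by rewrite cards0.
  - have [->|[_ [x' nx' /eqP[]]]] := deP _ x i nx; first by left.
    congr (tnth _ i); apply/src_inj/sepf; apply: leq_trans nx' _.
    rewrite -(card_imset _ (@inj_id 'I_N)) imset_id.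
    apply/subset_leq_card/subsetP => l; rewrite !inE ffunE eq_sym => /eqP/e_inj ->.
    by rewrite eqxx.
  - by rewrite leqn0 => /eqP -> ->; rewrite /Rdiv Rmult_0_l.
- move=> x A Ct leA; set r := received _ _ _.
  have nx : near x r.
    apply: leq_trans (_ : #|~: A| <= _).
      by rewrite cardsCs setCK card_ord leq_sub2l.
    apply/subset_leq_card/subsetP => l; rewrite !inE ffunE => /negPf ->.
    by rewrite eqxx.
  (* The default for letters outside the image of [e] is harmless: no message agrees with [r]
     there. *)
  pose r' l := odflt (f (src x) l) [pick p | e p == r l].
  have near_r' y : near y r -> N - T <= #|agreement (f (src y)) r'|.
    move/leq_trans; apply; apply: agreement_le => l eqr; rewrite /r'.
    case: pickP => [p /eqP|/(_ (f (src y) l))]; last by rewrite -eqr eqxx.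
    by rewrite -eqr => /e_inj ->.
  have [E leE EP] := lbf r'.
  have [|i|c lec ->] := @str_dist_bound K n d x (de r) [set i | pos i \in E].
  - apply: leq_trans leE; rewrite -(card_imset _ pos_inj).
    by apply/subset_leq_card/subsetP => _ /imsetP[j + ->]; rewrite inE.
  - have [->|[-> [x' nx' xx']]] := deP r x i nx; [by left|right; split=> //].
    rewrite inE; apply: contraR xx' => iE; apply/eqP; rewrite -!srcE.
    by apply: EP iE; apply: near_r'.
  - apply: Rmult_le_compat_r; last by apply: le_INR; apply/ssrnat.leP.
    by apply/Rlt_le/Rinv_0_lt_compat/lt_0_INR/ssrnat.ltP.
Qed.

(** * The two families of codes to be shared *)

Lemma encodable_polytope K N T : 1 < K -> 2 * T < N ->
  exists c, forall w, 0 < w ->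
    encodable K N T (N * w * (N - T) * w) (N * w * w + c * w)
      (FT T * (w * (N - T) * w)).
Proof.
move=> K_gt1 ltTN; have [c cP] := quantized_packet N (N - T) K_gt1.
exists c => w /cP[P [f [h [leP hf]]]].
have -> : N * w * (N - T) * w = #|{: 'I_N * 'I_w * 'I_(N - T) * 'I_w}|.
  by rewrite !card_prod !card_ord.
apply: (encodable_recode leP hf) => [x x'|r].
  exact: packet_separating (leq_subr _ _) _ _.
exact: (packet_list_bounded K (leq_subr T N) r (erefl _) ltTN).
Qed.

(** Two messages compatible with [r] share [N - 2 * T] packets, enough to determine polynomials of
    degree less than [N - 2 * T]. *)
Lemma encodable_mds K N T : 1 < K -> 2 * T < N ->
  exists c, forall w, 0 < w ->
    encodable K N T (N * w * (N - 2 * T) * w) (N * w * w + c * w) 0.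
Proof.
move=> K_gt1 ltTN; have [c cP] := quantized_packet N (N - 2 * T) K_gt1.
exists c => w /cP[P [f [h [leP hf]]]].
have -> : N * w * (N - 2 * T) * w = #|{: 'I_N * 'I_w * 'I_(N - 2 * T) * 'I_w}|.
  by rewrite !card_prod !card_ord.
apply: (encodable_recode leP hf) => [x x' le|r].
  by apply: (packet_separating (leq_subr _ _)); apply: leq_trans le; lia.
exists set0; rewrite ?cards0 // => x x' le le' i _.
suff -> : x = x' by []; apply: (packet_separating (leq_subr _ _)).
exact: agreement_setI le le'.
Qed.

(** * Lower bound on the packet length *)

Lemma mem_zip_tnth (A B : eqType) n (x : n.-tuple A) (y : n.-tuple B) i :
  (tnth x i, tnth y i) \in zip x y.
Proof.
rewrite (tnth_nth (tnth_default x i)) (tnth_nth (tnth_default y i)).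
by rewrite -nth_zip ?size_tuple // mem_nth // size_zip !size_tuple minnn.
Qed.

Lemma str_dist_finite K n (x : n.-tuple 'I_K) (y : n.-tuple (option 'I_K)) a :
  str_dist x y = Some a ->
  forall i, tnth y i = None \/ tnth y i = Some (tnth x i).
Proof.
rewrite /str_dist; case: ifP => // + _ i.
case yi: (tnth y i) => [s|]; last by left.
have [-> _|xs] := eqVneq s (tnth x i); first by right.
move=> /negP[]; rewrite has_map; apply/hasP.
exists (tnth x i, tnth y i); last by rewrite /= yi /= eq_sym (negPf xs).
exact: mem_zip_tnth.
Qed.

Lemma str_dist_eq0 K n (x : n.-tuple 'I_K) (y : n.-tuple (option 'I_K)) :
  0 < n -> str_dist x y = Some R0 -> forall i, tnth y i = Some (tnth x i).
Proof.
move=> n_gt0 d0 i; have [yi|//] := str_dist_finite d0 i.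
move: d0; rewrite /str_dist; case: ifP => // _ [].
set c := count _ _ => c0.
have : 0 < c.
  rewrite -has_count; apply/hasP; exists (tnth x i, tnth y i); last by rewrite yi.
  exact: mem_zip_tnth.
move=> /ssrnat.ltP/lt_0_INR c_gt0.
have /lt_0_INR/Rinv_0_lt_compat n_inv := ssrnat.ltP n_gt0.
by have := Rmult_lt_0_compat _ _ c_gt0 n_inv; rewrite -/(Rdiv _ _) c0; lra.
Qed.

(* Singleton-type bound: two messages sharing their first [N - T] packets are
   confused by altering the other [T] packets. *)
Lemma blen_le K N T (c : code K N) b :
  1 < K -> feasible c -> DT_le T c b -> blen c <= (N - T) * plen c.
Proof.
move=> K_gt1 feas dt; rewrite leqNgt; apply/negP => lt.
pose wd := widen_ord (leq_subr T N).
pose F (x : (blen c).-tuple 'I_K) := [ffun l : 'I_(N - T) => @enc K N c (wd l) x].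
have /injectivePn[x [x' xx' eF]] : ~~ injectiveb F.
  apply/negP => /injectiveP/leq_card.
  rewrite card_ffun !card_tuple !card_ord -expnM leq_exp2l //.
  by rewrite leqNgt mulnC lt.
pose A := ~: (wd @: setT).
have leA : #|A| <= T.
  have wd_inj : injective wd by move=> l l' /(congr1 val)/= /val_inj.
  by rewrite /A cardsCs setCK (card_imset _ wd_inj) cardsT !card_ord leq_subCl.
pose Ct := [ffun l => @enc K N c l x'].
(* What is received is the honest encoding of [x']: feasibility outputs [x'], finite distortion
   allows only symbols of [x] or erasures. *)
have rE : received x A Ct = Ct.
  apply/ffunP => l; rewrite !ffunE inE.
  case: imsetP => [[l' _ ->]|//] /=.
  by have /ffunP/(_ l') := eF; rewrite !ffunE.
have := dt x A Ct leA; rewrite rE.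
case xd: (str_dist _ _) => [a|//] _.
case/eqP: xx'; apply: eq_from_tnth => i.
have := str_dist_eq0 (blen_pos c) (feas x') i.
by have [->|->] := str_dist_finite xd i => // -[].
Qed.

(** * Rate estimates and time sharing *)

Open Scope R_scope.

Lemma nat_floor_ex (y : R) : 0 <= y -> exists a : nat, INR a <= y < INR a + 1.
Proof.
move=> y0; have [h1 h2] := base_Int_part y.
have z0 : Z.le 0 (Int_part y).
  by apply/Z.lt_succ_r/lt_IZR; rewrite succ_IZR; lra.
by exists (Z.to_nat (Int_part y)); rewrite INR_IZR_INZ Z2Nat.id //; lra.
Qed.

Lemma INRD (m n : nat) : INR (m + n)%N = INR m + INR n.
Proof. exact: plus_INR. Qed.

Lemma INRM (m n : nat) : INR (m * n)%N = INR m * INR n.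
Proof. exact: mult_INR. Qed.

Lemma INRB (m n : nat) : (n <= m)%N -> INR (m - n)%N = INR m - INR n.
Proof. by move=> /ssrnat.leP; apply: minus_INR. Qed.

Lemma INR_leq (m n : nat) : (m <= n)%N -> INR m <= INR n.
Proof. by move=> /ssrnat.leP; apply: le_INR. Qed.

Lemma no_achievable_below K N T Rt D :
  (1 < K)%N -> (T < N)%N -> Rt < 1 / (INR N - INR T) -> ~ achievable K N T Rt D.
Proof.
move=> K_gt1 ltTN; rewrite -INRB 1?ltnW // => ltR ach.
have k_gt0 : 0 < INR (N - T) by apply: (lt_INR 0); apply/ssrnat.ltP; rewrite subn_gt0.
(* Half the gap keeps the rate strictly below the threshold. *)
have [|c [feas [rt dt]]] := ach ((1 / INR (N - T) - Rt) / 2); first by lra.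
have /INR_leq := blen_le K_gt1 feas dt; rewrite INRM => len.
have n_gt0 : 0 < INR (blen c) by apply: (lt_INR 0); apply/ssrnat.ltP/blen_pos.
have rateE : rate c * INR (blen c) = INR (plen c) by rewrite /rate; field; lra.
have : rate c < / INR (N - T) by lra.
move=> /(Rmult_lt_compat_l _ _ _ k_gt0); rewrite Rinv_r; last by lra.
move=> /(Rmult_lt_compat_r _ _ _ n_gt0); rewrite Rmult_assoc rateE; lra.
Qed.

(** Packet length against [r + eps] times block length, for [a] the integer part of [lam * w].
    Rounding costs [t] and the packet overheads [c1], [c2], relative to a main term larger by a
    factor [w]. *)
Lemma time_share_rate (n t k1 k2 r lam a w c1 c2 eps : R) :
  0 <= t -> 1 <= k2 -> k2 <= k1 -> 1 <= n -> 0 <= c1 -> 0 <= c2 ->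
  k1 = k2 + t -> lam * t = k1 - k1 * k2 * r ->
  0 <= a -> a <= w -> 1 <= w -> lam * w < a + 1 -> t + c1 + c2 <= w * eps ->
  a * k2 * (n * w * w + c1 * w) + (w - a) * k1 * (n * w * w + c2 * w)
  <= (r + eps) * (w * w * w * n * k1 * k2).
Proof.
move=> t0 k2_1 k21 n1 c1_0 c2_0 k1E lamE a0 aw w1 lta weps.
have n0 : 0 <= n by lra.
have [k1P k2P nP] : [/\ k1 <= n * k1 * k2, k2 <= n * k1 * k2 & n <= n * k1 * k2].
  have k1_le : k1 <= k1 * k2 by nra.
  have k2_le : k2 <= k1 * k2 by nra.
  by split; nra.
set p := n * k1 * k2 in k1P k2P nP.
have p0 : 0 <= p by lra.
have ww : 0 <= w * w by nra.
have E1 : a * k2 + (w - a) * k1 <= w * k1 * k2 * r + t.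
  have -> : w * k1 * k2 * r = w * k1 - w * (lam * t) by rewrite lamE; ring.
  by rewrite k1E; nra.
have E2 : a * k2 * c1 + (w - a) * k1 * c2 <= w * p * (c1 + c2).
  have h1 : a * k2 <= w * p by apply: Rmult_le_compat; lra.
  have h2 : (w - a) * k1 <= w * p by apply: Rmult_le_compat; lra.
  have := Rmult_le_compat_r c1 _ _ c1_0 h1.
  by have := Rmult_le_compat_r c2 _ _ c2_0 h2; lra.
have E3 : n * (w * w * t) <= p * (w * w * t).
  by apply: Rmult_le_compat_r nP; apply: Rmult_le_pos.
have E1' : n * w * w * (a * k2 + (w - a) * k1) <=
           n * w * w * (w * k1 * k2 * r + t).
  by apply: Rmult_le_compat_l E1; rewrite Rmult_assoc; apply: Rmult_le_pos.
have E2' := Rmult_le_compat_l w _ _ ltac:(lra) E2.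
have E4 : w * w * p * (t + c1 + c2) <= w * w * p * (w * eps).
  by apply: Rmult_le_compat_l weps; apply: Rmult_le_pos.
have -> : (r + eps) * (w * w * w * n * k1 * k2) =
  n * w * w * (w * k1 * k2 * r) + w * w * p * (w * eps) by rewrite /p; ring.
lra.
Qed.

(* Time sharing: [a] out of [w] parts use the polytope code of rate [1/(N-T)],
   the others the code of rate [1/(N-2T)]. *)
Lemma achievable_above K N T Rt :
  (1 < K)%N -> (0 < T)%N -> (2 * T < N)%N ->
  1 / (INR N - INR T) <= Rt -> Rt <= 1 / (INR N - 2 * INR T) ->
  achievable K N T Rt
    (INR (FT T) * (INR N - INR T) * (1 - (INR N - 2 * INR T) * Rt)
       / (INR N * INR T)).
Proof.
move=> K_gt1 T_gt0 ltTN geR leR eps eps_gt0.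
have [c1 enc1] := encodable_polytope K_gt1 ltTN.
have [c2 enc2] := encodable_mds K_gt1 ltTN.
have T1 : 1 <= INR T by apply: (INR_leq (m := 1)).
have k2E : INR (N - 2 * T) = INR N - 2 * INR T by rewrite INRB ?INRM // ltnW.
have k1E : INR (N - T) = INR N - INR T by rewrite INRB //; lia.
have k2_1 : 1 <= INR (N - 2 * T) by apply: (INR_leq (m := 1)); lia.
rewrite -k1E in geR *; rewrite -k2E in leR *.
set k1 := INR (N - T) in k1E geR *; set k2 := INR (N - 2 * T) in k2E k2_1 leR *.
(* Share of the polytope code: affine in [Rt], equal to 1 at [1 / k1] and 0 at [1 / k2]. *)
pose lam := k1 * (1 - k2 * Rt) / INR T.
have lamT : lam * INR T = k1 - k1 * k2 * Rt by rewrite /lam; field; lra.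
have geR' : 1 <= k1 * Rt.
  have := Rmult_le_compat_l k1 _ _ ltac:(lra) geR.
  by rewrite /Rdiv Rmult_1_l Rinv_r; lra.
have leR' : k2 * Rt <= 1.
  have := Rmult_le_compat_l k2 _ _ ltac:(lra) leR.
  by rewrite /Rdiv Rmult_1_l Rinv_r; lra.
have lam0 : 0 <= lam by nra.
have lam1 : lam <= 1 by nra.
pose C := INR T + INR c1 + INR c2.
have c1_0 := pos_INR c1; have c2_0 := pos_INR c2.
have [w [_ ltw]] : exists w, INR w <= C / eps < INR w + 1.
  apply: nat_floor_ex; apply: Rlt_le; apply: Rdiv_lt_0_compat => //.
  by rewrite /C; lra.
rewrite -S_INR in ltw; move: (w.+1) (ltn0Sn w) ltw => {}w w_gt0 ltw.
have w1 : 1 <= INR w by apply: (INR_leq (m := 1)).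
have weps : C <= INR w * eps.
  apply: Rlt_le; have := Rmult_lt_compat_r _ _ _ eps_gt0 ltw.
  by rewrite /Rdiv Rmult_assoc Rinv_l; lra.
have [a [lea lta]] := nat_floor_ex (y := lam * INR w) ltac:(nra).
have aw : INR a <= INR w by nra.
have law : (a <= w)%N by apply/ssrnat.leP/INR_le.
have K_gt0 := ltnW K_gt1.
(* The extra factors equalize the two block lengths, so the shares are exactly [a] and [w - a] out
   of [w]. *)
have := encodableD (encodableM (a * (N - 2 * T)) K_gt0 (enc1 w w_gt0))
                   (encodableM ((w - a) * (N - T)) K_gt0 (enc2 w w_gt0)).
set n := (_ + _)%N; set m := (_ + _)%N; set d := (_ + _)%N => enc.
have nE : INR n = INR w * INR w * INR w * INR N * k1 * k2.
  by rewrite /n !(INRD, INRM) (INRB law) -/k1 -/k2; ring.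
have n_gt0 : (0 < n)%N.
  apply/ssrnat.ltP/INR_lt; rewrite nE /=.
  by repeat apply: Rmult_lt_0_compat; lra.
have [c [feas rt dt]] := encodable_code K_gt1 n_gt0 enc.
have nr_gt0 : 0 < INR n by apply: (lt_INR 0); apply/ssrnat.ltP.
exists c; split=> //; split.
- rewrite rt; apply: (Rmult_le_reg_r (INR n)) => //.
  rewrite /Rdiv Rmult_assoc Rinv_l ?Rmult_1_r; last by lra.
  rewrite nE /m !(INRD, INRM) (INRB law) -/k1 -/k2.
  apply: (time_share_rate (t := INR T) (lam := lam)) => //; try lra.
  exact: pos_INR.
- move=> x A Ct leA; have := dt x A Ct leA.
  case: (str_dist _ _) => [b|//] /= leb.
  apply: Rle_trans leb _; rewrite nE /d; move: (FT T) => F.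
  have F0 := pos_INR F; rewrite !(INRD, INRM) -/k1 -/k2 /=.
  have -> : INR F * k1 * (1 - k2 * Rt) / (INR N * INR T) = lam * (INR F / INR N).
    by rewrite /lam; field; lra.
  rewrite !Rmult_0_r Rplus_0_r.
  have -> : INR a * k2 * (INR F * (INR w * k1 * INR w)) /
      (INR w * INR w * INR w * INR N * k1 * k2) = (INR a / INR w) * (INR F / INR N).
    by field; lra.
  have FN : 0 <= INR F / INR N.
    by apply: Rmult_le_pos => //; apply/Rlt_le/Rinv_0_lt_compat; lra.
  (* As [a] is rounded down, the distortion needs none of [eps]. *)
  have : INR a / INR w <= lam.
    apply: (Rmult_le_reg_r (INR w)); first lra.
    by rewrite /Rdiv Rmult_assoc Rinv_l; lra.
  by move=> /(Rmult_le_compat_r _ _ _ FN); lra.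
Qed.

Theorem theorem1 (K N T : nat) :
  (2 <= K)%N -> (1 <= T)%N -> (T + (T * T) %/ 4 + 2 <= N)%N ->
  (forall Rt : R, (0 <= Rt) -> (Rt < 1 / (INR N - INR T)) ->
     ~ (exists D : R, achievable K N T Rt D))
  /\
  (forall Rt : R,
     (1 / (INR N - INR T) <= Rt) -> (Rt <= 1 / (INR N - 2 * INR T)) ->
     achievable K N T Rt
       (INR (FT T) * (INR N - INR T) * (1 - (INR N - 2 * INR T) * Rt)
          / (INR N * INR T))).
Proof.
move=> K_gt1 T_gt0 leN.
(* AM-GM for [T] and 2 gives [T <= (T * T) %/ 4 + 1]. *)
have ltTN : (2 * T < N)%N.
  have := divn_eq (T * T) 4; have := ltn_pmod (T * T) (isT : (0 < 4)%N).
  have : (4 * T <= T * T + 4)%N by have := (nat_AGM2 T 2).1; lia.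
  lia.
split=> [Rt _ ltR [D]|Rt]; last exact: achievable_above.
by apply: no_achievable_below ltR => //; lia.
Qed.
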